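(* The restriction of the pairing $\langle-,-\rangle$ to $\mathcal{H}_{\mathcal{SPP}}$ is nondegenerate.
   Context: $\mathbb{K}$ is a commutative field. A double poset is a finite set with two partial orders $(P,\leq_1,\leq_2)$, considered up to isomorphism (bijections preserving and reflecting both orders). A plane poset is a double poset $(P,\leq_h,\leq_r)$ such that two distinct elements are comparable for $\leq_h$ if and only if they are not comparable for $\leq_r$. Then the relation $x\leq y$ iff ($x\leq_h y$ or $x\leq_r y$) is a total order on $P$, and the double poset $(P,\leq_h,\leq)$ (so $\leq_1=\leq_h$ and $\leq_2=\leq$) is called a special plane poset. $\mathcal{H}_{\mathcal{SPP}}$ is the $\mathbb{K}$-vector space with basis the set of isoclasses of special plane posets. The pairing is the symmetric bilinear form such that, for $P,Q$ special plane posets, $\langle P,Q\rangle$ is the (image in $\mathbb{K}$ of the) number of bijections $\sigma:P\to Q$ such that, for all $i,j\in P$: ($i\leq_1 j$ in $P$) implies ($\sigma(i)\leq_2\sigma(j)$ in $Q$), and ($\sigma(i)\leq_1\sigma(j)$ in $Q$) implies ($i\leq_2 j$ in $P$). *)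

(* Defs.v *)
From HB Require Import structures.
From mathcomp Require Import all_boot all_order all_algebra.
From mathcomp Require Import finmap monalg.

Set Implicit Arguments.
Unset Strict Implicit.
Unset Printing Implicit Defensive.

Import GRing.Theory.
Local Open Scope ring_scope.
Local Open Scope quotient_scope.

Definition partial_order (T : finType) (r : rel T) : bool :=
  [&& [forall x, r x x],
      [forall x, forall y, r x y && r y x ==> (x == y)]
    & [forall x, forall y, forall z, r x y && r y z ==> r x z]].

Lemma partial_orderP (T : finType) (r : rel T) :
  reflect [/\ reflexive r, antisymmetric r & transitive r] (partial_order r).
Proof.
apply: (iffP and3P) => -[].
  move=> /forallP rr /'forall_forallP ra /'forall_'forall_forallP rt; split=> //.
    by move=> x y /(implyP (ra x y)) /eqP.
  by move=> y x z rxy ryz; apply: (implyP (rt x y z)); rewrite rxy.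
move=> rr ra rt; split; first exact/forallP.
  by apply/'forall_forallP=> x y; apply/implyP=> /ra ->.
apply/'forall_'forall_forallP=> x y z; apply/implyP=> /andP[]; exact: rt.
Qed.

Definition comparable_in (T : Type) (r : rel T) (x y : T) : bool := r x y || r y x.

Definition plane_poset (T : finType) (rh rr : rel T) : bool :=
  [&& partial_order rh, partial_order rr
    & [forall x, forall y, (x != y) ==> (comparable_in rh x y == ~~ comparable_in rr x y)]].

Definition rel_of (T : finType) (A : {set T * T}) : rel T :=
  fun x y => (x, y) \in A.

(* [(T, r1, r2)] is [(P, <=_h, <=)] for some plane poset [(P, <=_h, <=_r)];
   the relation [<=_r] is encoded by its graph [R]. *)
Definition special_plane (T : finType) (r1 r2 : rel T) : bool :=
  [exists R : {set T * T}, plane_poset r1 (rel_of R) &&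
    [forall x, forall y, r2 x y == (r1 x y || rel_of R x y)]].

Lemma special_planeP (T : finType) (r1 r2 : rel T) :
  reflect (exists2 rr : rel T, plane_poset r1 rr
                             & forall x y, r2 x y = r1 x y || rr x y)
          (special_plane r1 r2).
Proof.
apply: (iffP existsP) => [[R /andP[pR /'forall_'forall_eqP e]]|[rr prr e]].
  by exists (rel_of R).
pose R := [set p | rr p.1 p.2].
have eR x y : rel_of R x y = rr x y by rewrite /rel_of inE.
exists R; apply/andP; split; last first.
  by apply/'forall_'forall_eqP=> x y; rewrite e eR.
case/and3P: prr => p1 /partial_orderP[rr1 rr2 rr3] /'forall_forallP c.
rewrite /plane_poset p1 /=; apply/andP; split.
  apply/partial_orderP; split=> [x|x y|y x z]; rewrite !eR //.
  - exact: rr2.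
  - exact: rr3.
by apply/'forall_forallP=> x y; move: (c x y); rewrite /comparable_in !eR.
Qed.

Definition bijectiveb (S T : finType) (f : {ffun S -> T}) : bool :=
  injectiveb f && [forall y, exists x, f x == y].

Lemma bijectivebP (S T : finType) (f : {ffun S -> T}) :
  reflect (bijective f) (bijectiveb f).
Proof.
apply: (iffP andP) => [[/injectiveP fi /'forall_existsP fs]|[g fK gK]].
  pose g y := xchoose (fs y).
  have gK : cancel g f by move=> y; apply/eqP/(xchooseP (fs y)).
  by exists g => // x; apply: fi; rewrite gK.
split; first by apply/injectiveP; exact: can_inj fK.
by apply/'forall_existsP=> y; exists (g y); rewrite gK.
Qed.

Definition isob (S T : finType) (r1 r2 : rel S) (s1 s2 : rel T) : bool :=
  [exists f : {ffun S -> T}, bijectiveb f &&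
    [forall x, forall y, (s1 (f x) (f y) == r1 x y) && (s2 (f x) (f y) == r2 x y)]].

Lemma isobP (S T : finType) (r1 r2 : rel S) (s1 s2 : rel T) :
  reflect (exists2 f : S -> T, bijective f &
             {mono f : x y / r1 x y >-> s1 x y} /\
             {mono f : x y / r2 x y >-> s2 x y})
          (isob r1 r2 s1 s2).
Proof.
apply: (iffP existsP) => [[f /andP[/bijectivebP fb /'forall_forallP h]]|[f fb [h1 h2]]].
  by exists f => //; split=> x y; case/andP: (h x y) => /eqP e1 /eqP e2.
exists (finfun f); apply/andP; split.
  by apply/bijectivebP; apply: (eq_bij fb) => x; rewrite ffunE.
by apply/'forall_forallP=> x y; rewrite !ffunE h1 h2 !eqxx.
Qed.

(* Up to isomorphism a finite set is some ['I_n]; the two orders are encoded by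
   their graphs so that double posets form a [choiceType].
   See [dposet_cover] for arbitrary finite carriers. *)
Definition dposet_data := {n : nat & ({set 'I_n * 'I_n} * {set 'I_n * 'I_n})%type}.

Definition dposet :=
  {D : dposet_data | partial_order (rel_of (tagged D).1)
                   && partial_order (rel_of (tagged D).2)}.

Definition dposet_carrier (P : dposet) : finType := 'I_(tag (val P)).
Coercion dposet_carrier : dposet >-> finType.
Definition le1 (P : dposet) : rel P := rel_of (tagged (val P)).1.
Definition le2 (P : dposet) : rel P := rel_of (tagged (val P)).2.

Definition iso (P Q : dposet) : bool :=
  isob (@le1 P) (@le2 P) (@le1 Q) (@le2 Q).

Lemma dposet_cover (T : finType) (r1 r2 : rel T) :
  partial_order r1 -> partial_order r2 ->
  exists P : dposet, isob r1 r2 (@le1 P) (@le2 P).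
Proof.
pose A (r : rel T) : {set 'I_#|T| * 'I_#|T|} :=
  [set p | r (enum_val p.1) (enum_val p.2)].
have poA r : partial_order r -> partial_order (rel_of (A r)).
  move=> /partial_orderP[rr ra rt]; apply/partial_orderP; rewrite /rel_of.
  split=> [x|x y|y x z]; rewrite !inE //=; last exact: rt.
  by move=> /ra /enum_val_inj.
move=> p1 p2.
pose D : dposet_data := Tagged _ (A r1, A r2).
have DP : partial_order (rel_of (tagged D).1) && partial_order (rel_of (tagged D).2).
  by rewrite !poA.
exists (exist _ D DP); apply/isobP; exists enum_rank; first exact: enum_rank_bij.
by split=> x y; rewrite /le1 /le2 /rel_of /= inE /= !enum_rankK.
Qed.

Lemma iso_refl : reflexive iso.
Proof. by move=> P; apply/isobP; exists id; [exists id|]. Qed.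

Lemma iso_sym : symmetric iso.
Proof.
suff h P Q : iso P Q -> iso Q P by move=> P Q; apply/idP/idP; exact: h.
move=> /isobP[f [g fK gK] [h1 h2]]; apply/isobP; exists g; first by exists f.
by split=> x y; rewrite -?h1 -?h2 !gK.
Qed.

Lemma iso_trans : transitive iso.
Proof.
move=> Q P R /isobP[f fb [f1 f2]] /isobP[g gb [g1 g2]].
apply/isobP; exists (g \o f); first exact: bij_comp.
by split=> x y /=; rewrite ?g1 ?g2.
Qed.

Canonical iso_equiv := EquivRel iso iso_refl iso_sym iso_trans.

Definition DP := {eq_quot iso_equiv}.
HB.instance Definition _ := EqQuotient.on DP.
HB.instance Definition _ := Choice.on DP.

Lemma eq_DP (P Q : dposet) : (\pi_DP P == \pi_DP Q) = iso P Q.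
Proof. by rewrite eqmodE. Qed.

Definition special (P : DP) : bool :=
  special_plane (@le1 (repr P)) (@le2 (repr P)).

Lemma special_plane_iso (S T : finType) (r1 r2 : rel S) (s1 s2 : rel T) :
  isob r1 r2 s1 s2 -> special_plane s1 s2 -> special_plane r1 r2.
Proof.
case/isobP=> f fb [h1 h2] /special_planeP[rr].
case/and3P=> /partial_orderP[p1 p2 p3] /partial_orderP[q1 q2 q3] /'forall_forallP c e.
have fi := bij_inj fb.
apply/special_planeP; exists (relpre f rr); last by move=> x y /=; rewrite -h1 -h2.
apply/and3P; split.
- apply/partial_orderP; split=> [x|x y|y x z]; rewrite -!h1 //.
    by move=> /p2 /fi.
  exact: p3.
- apply/partial_orderP; split=> [x|x y|y x z] //=.
    by move=> /q2 /fi.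
  exact: q3.
apply/'forall_forallP=> x y; move: (c (f x) (f y)).
by rewrite (inj_eq fi) /comparable_in /= !h1.
Qed.

Lemma special_pi (P : dposet) :
  special (\pi P) = special_plane (@le1 P) (@le2 P).
Proof.
have h : iso P (repr (\pi_DP P)) by rewrite -eq_DP reprK.
apply/idP/idP; apply: special_plane_iso => //.
by rewrite -/(iso _ _) iso_sym.
Qed.

Definition pictures (P Q : dposet) : {set {ffun P -> Q}} :=
  [set s : {ffun P -> Q} | bijectiveb s &&
    [forall i, forall j, (le1 i j ==> le2 (s i) (s j)) &&
                         (le1 (s i) (s j) ==> le2 i j)]].

Lemma picturesP (P Q : dposet) (s : {ffun P -> Q}) :
  reflect [/\ bijective s, {homo s : i j / le1 i j >-> le2 i j}
            & forall i j, le1 (s i) (s j) -> le2 i j]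
          (s \in pictures P Q).
Proof.
rewrite inE; apply: (iffP andP).
  case=> /bijectivebP sb /'forall_forallP h; split=> // i j;
    by case/andP: (h i j) => /implyP h1 /implyP h2.
case=> sb h1 h2; split; first exact/bijectivebP.
by apply/'forall_forallP=> i j; apply/andP; split; apply/implyP; [exact: h1|exact: h2].
Qed.

Definition npictures (P Q : DP) : nat := #|pictures (repr P) (repr Q)|.

Lemma leq_pictures_iso (P P' Q Q' : dposet) :
  iso P P' -> iso Q Q' -> (#|pictures P Q| <= #|pictures P' Q'|)%N.
Proof.
case/isobP=> f [f' fK f'K] [f1 f2] /isobP[g gb [g1 g2]].
pose F (s : {ffun P -> Q}) : {ffun P' -> Q'} := [ffun x => g (s (f' x))].
have Fi : injective F.
  move=> s t /ffunP e; apply/ffunP=> x; apply: (bij_inj gb).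
  by have := e (f x); rewrite !ffunE fK.
rewrite -(card_imset _ Fi); apply/subset_leq_card/subsetP=> _ /imsetP[s + ->].
move=> /picturesP[sb s1 s2]; apply/picturesP; split.
- suff sF : bijective (g \o (s \o f')) by apply: (eq_bij sF) => x; rewrite ffunE.
  by apply: bij_comp gb _; apply: bij_comp sb _; exists f.
- move=> i j; rewrite !ffunE g2 -[i in le1 i]f'K -[j in le1 _ j]f'K f1.
  exact: s1.
- move=> i j; rewrite !ffunE g1 -[i in le2 i]f'K -[j in le2 _ j]f'K f2.
  exact: s2.
Qed.

Lemma npictures_pi (P Q : dposet) : npictures (\pi P) (\pi Q) = #|pictures P Q|.
Proof.
have h R : iso R (repr (\pi_DP R)) by rewrite -eq_DP reprK.
apply/eqP; rewrite eqn_leq !leq_pictures_iso //; by rewrite iso_sym.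
Qed.

Lemma leq_pictures_sym (P Q : dposet) : (#|pictures P Q| <= #|pictures Q P|)%N.
Proof.
pose G (s : {ffun P -> Q}) (y : Q) : pred P := fun x => s x == y.
have [->|[s0 s0P]] := set_0Vmem (pictures P Q); first by rewrite cards0.
have x0 y : exists x, G s0 y x.
  by case/picturesP: s0P => -[g _ gK] _ _; exists (g y); apply/eqP.
pose F (s : {ffun P -> Q}) : {ffun Q -> P} :=
  [ffun y => odflt (xchoose (x0 y)) [pick x | s x == y]].
have FK (s : {ffun P -> Q}) : bijective s -> cancel (F s) s /\ cancel s (F s).
  move=> [g sK gK]; have h : cancel (F s) s.
    move=> y; rewrite ffunE; case: pickP => /= [x /eqP //|/(_ (g y))].
    by rewrite gK eqxx.
  by split=> // x; apply: (can_inj sK); rewrite h.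
rewrite -(@card_in_imset _ _ F); last first.
  move=> s t /picturesP[/FK[s1 s2] _ _] /picturesP[/FK[t1 t2] _ _] e.
  by apply/ffunP=> x; rewrite -[LHS]t1 -e s2.
apply/subset_leq_card/subsetP=> _ /imsetP[s /picturesP[sb s1 s2] ->].
have [h1 h2] := FK s sb; apply/picturesP; split; first by exists s.
- by move=> i j ij; apply: s2; rewrite !h1.
- by move=> i j /s1; rewrite !h1.
Qed.

Lemma npictures_sym (P Q : DP) : npictures P Q = npictures Q P.
Proof. by apply/eqP; rewrite eqn_leq !leq_pictures_sym. Qed.

Section FreeModule.
Variables (K : fieldType) (I : choiceType).

Section Form.
Variable c : I -> I -> nat.

(* The bilinear form on the free module [{malg K[I]}] given by [c] on the basis. *)
Definition free_form (x y : {malg K[I]}) : K :=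
  \sum_(i <- msupp x) \sum_(j <- msupp y) x@_i * y@_j * (c i j)%:R.

Lemma free_formU (i j : I) : free_form << i >> << j >> = (c i j)%:R.
Proof.
by rewrite /free_form !msuppU oner_eq0 !big_seq_fset1 !mcoeffUU !mul1r.
Qed.

Lemma free_formEl (A : {fset I}) (x y : {malg K[I]}) : (msupp x `<=` A)%fset ->
  free_form x y = \sum_(i <- A) x@_i * \sum_(j <- msupp y) y@_j * (c i j)%:R.
Proof.
move=> sA; rewrite /free_form.
under eq_bigr do [under eq_bigr do rewrite -mulrA; rewrite -mulr_sumr].
by apply: big_fset_incl => // i _ /mcoeff_outdom ->; rewrite mul0r.
Qed.

Lemma free_form_linearl (y : {malg K[I]}) : scalar (free_form^~ y).
Proof.
move=> a u v /=; pose A := (msupp u `|` msupp v)%fset.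
have sA : (msupp (a *: u + v) `<=` A)%fset.
  apply: fsubset_trans (msuppD_le _ _) _.
  by rewrite fsetSU // msuppZ_le.
have sU : (msupp u `<=` A)%fset by exact: fsubsetUl.
have sV : (msupp v `<=` A)%fset by exact: fsubsetUr.
rewrite (free_formEl _ sA) (free_formEl _ sU) (free_formEl _ sV).
rewrite mulr_sumr -big_split /=; apply: eq_bigr => i _.
by rewrite mcoeffD mcoeffZ mulrDl mulrA.
Qed.

End Form.

Lemma free_form_sym (c : I -> I -> nat) (x y : {malg K[I]}) :
  free_form c x y = free_form (fun i j => c j i) y x.
Proof.
rewrite /free_form exchange_big /=.
by apply: eq_bigr => j _; apply: eq_bigr => i _; rewrite [x@_i * _]mulrC.
Qed.

Lemma free_form_linearr (c : I -> I -> nat) (x : {malg K[I]}) :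
  scalar (free_form c x).
Proof. by move=> a u v; rewrite !(free_form_sym c x) free_form_linearl. Qed.

HB.instance Definition _ (c : I -> I -> nat) :=
  bilinear_isBilinear.Build K {malg K[I]} {malg K[I]} K *%R *%R
    (free_form c) (free_form_linearl c, free_form_linearr c).

(* The submodule of [{malg K[I]}] with basis the elements of [I] satisfying [p]. *)
Definition spanned_by (p : pred I) : {pred {malg K[I]}} :=
  fun x => all p (msupp x).

Fact spanned_by_submod (p : pred I) : submod_closed (spanned_by p).
Proof.
split=> [|a u v /allP hu /allP hv]; first by rewrite unfold_in msupp0.
apply/allP=> i /(fsubsetP (msuppD_le _ _)); rewrite in_fsetU.
by case/orP=> [/(fsubsetP (msuppZ_le _ _))|]; [exact: hu|exact: hv].
Qed.

HB.instance Definition _ (p : pred I) :=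
  GRing.isSubmodClosed.Build K {malg K[I]} (spanned_by p) (spanned_by_submod p).

End FreeModule.

Definition H_DP (K : fieldType) := {malg K[DP]}.

Definition pairing (K : fieldType) : {bilinear H_DP K -> H_DP K -> K | *%R & *%R} :=
  free_form npictures.

Definition H_SPP (K : fieldType) : submodClosed (H_DP K) :=
  @spanned_by K DP special.

Lemma pairingU (K : fieldType) (P Q : DP) :
  @pairing K << P >> << Q >> = (npictures P Q)%:R.
Proof. exact: free_formU. Qed.

Lemma pairing_sym (K : fieldType) (x y : H_DP K) : pairing K x y = pairing K y x.
Proof.
transitivity (free_form (fun P Q => npictures Q P) y x); first exact: free_form_sym.
by do 2![apply: eq_bigr => ? _]; rewrite npictures_sym.
Qed.

(* Nondegeneracy of the restriction of [f] to the submodule [V]. *)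
Definition nondegenerate_on (K : fieldType) (U : lmodType K)
    (f : {bilinear U -> U -> K | *%R & *%R}) (V : submodClosed U) : Prop :=
  (forall x, x \in V -> (forall y, y \in V -> f x y = 0) -> x = 0) /\
  (forall y, y \in V -> (forall x, x \in V -> f x y = 0) -> y = 0).

(* Main.v *)
Require Import Defs.
From mathcomp Require Import all_boot all_order all_algebra.
From mathcomp Require Import fingroup perm finmap monalg.

(** Let [Inv s] be the set of inversions of a permutation [s] of [{0..n-1}].
A special plane poset of size [n] is the same thing as a permutation [s] : number
the elements along the total order [<=_2]; turning [<=_r] upside down gives a second
total order, and [s] compares the two, so that [i <=_1 j] means that [i <= j]
and that [s] does not invert the pair [(i, j)] ([special_plane_poset_of]). Call the result [P_s].

A bijection between two such posets is a permutation [u], and the two conditions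
that make it contribute to the pairing say that [Inv u] is included in [Inv s] and
[Inv u^-1] in [Inv t] ([card_pictures_poset_of]). In other words
[<P_s, P_t>] counts the [u] with [u <= s] and [u^-1 <= t] for the weak order
on permutations, which is an order because a permutation is determined by its
inversions ([inversions_inj]). On the basis of the [P_s] the matrix of the pairing is
therefore [Z^T D Z], with [Z] the zeta matrix of the weak order, which is
unitriangular, and [D] the permutation matrix of [u |-> u^-1]. Each factor is
invertible over every field, and posets of different sizes are orthogonal.

The proof inverts the two zeta matrices one after the other. For [x] in the
kernel let [a u] be the sum of the coefficients of [x] at the [P_s] with [u <= s]
([upper_sum]). Then [<x, P_t>] is the sum of the [a u] with [u^-1 <= t]
([pairing_poset_of]); taking [t = u^-1], by induction on the number of
inversions of [u^-1], shows that [a] vanishes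
([upper_sum_eq0]), and taking [u = s] with [s] maximal in the support of [x]
shows that [x] vanishes. *)

Set Implicit Arguments.
Unset Strict Implicit.
Unset Printing Implicit Defensive.

Import GRing.Theory.
Local Open Scope ring_scope.
Local Open Scope quotient_scope.

(** * Inversions of a permutation *)

Section Inversions.
Variable n : nat.
Implicit Types s t u : 'S_n.

Definition inversions s : {set 'I_n * 'I_n} :=
  [set p : 'I_n * 'I_n | (p.1 < p.2)%N && (s p.2 < s p.1)%N].

Lemma card_ltn_perm s i : #|[set j | (s j < s i)%N]| = s i.
Proof.
rewrite -(card_imset _ (@perm_inj _ s)).
have -> : s @: [set j | (s j < s i)%N] = [set j : 'I_n | (j < s i)%N].
  apply/setP=> j; rewrite inE; apply/imsetP/idP => [[k + ->]|ji].
    by rewrite inE.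
  by exists ((s^-1)%g j); rewrite ?inE permKV.
by rewrite -sum1dep_card -(big_ord_widen n (fun=> 1%N) (ltnW (ltn_ord (s i))))
  sum1_card card_ord.
Qed.

(** The value [s i] is the number of [j] with [s j < s i], and the inversions of
[s] tell which [j] these are. *)
Lemma inversions_inj : injective inversions.
Proof.
move=> s t e; apply/permP=> i; apply/val_inj; rewrite /= -(card_ltn_perm s) -(card_ltn_perm t).
apply: eq_card => j; rewrite !inE.
have h (k l : 'I_n) : (k < l)%N -> (s l < s k)%N = (t l < t k)%N.
  by move=> kl; move/setP/(_ (k, l)): e; rewrite !inE /= kl.
have [ij|ji|/val_inj->] := ltngtP i j; [exact: h| |by rewrite !ltnn].
by rewrite !ltn_neqAle !(inj_eq val_inj) !(inj_eq perm_inj) leqNgt (h _ _ ji) -leqNgt.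
Qed.

Lemma inversions_ltn_card s t : inversions s \subset inversions t -> s != t ->
  (#|inversions s| < #|inversions t|)%N.
Proof.
by move=> st ne; apply: proper_card; rewrite properEneq st (inj_eq inversions_inj) ne.
Qed.

(** A form of inclusion with weak inequalities only, which is what the orders of a
poset provide. *)
Lemma inversions_subsetP s t :
  reflect (forall i j : 'I_n, (i <= j -> t i <= t j -> s i <= s j)%N)
          (inversions s \subset inversions t).
Proof.
apply: (iffP subsetP) => [h i j ij tij|h [i j]].
  rewrite leqNgt; apply/negP=> sji.
  have ltij : (i < j)%N.
    by rewrite ltn_neqAle ij andbT; apply: contraTneq sji => /val_inj->; rewrite ltnn.
  by have := h (i, j); rewrite !inE /= ltij sji ltnNge tij => /(_ isT).
rewrite !inE /= => /andP[ij sji]; rewrite ij ltnNge; apply: contraL sji => tij.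
by rewrite -leqNgt h // ltnW.
Qed.

End Inversions.

(** * Special plane posets as permutations *)

(** For transitivity, suppose that [x <= y] for one of the two orders and [y <= z] for
the other. If [z <= x] held for either order, it would combine with one of the two
hypotheses into a comparison of [x, y] or of [y, z] for the order in which they
are not already comparable, and force two of the elements to coincide. *)
Lemma plane_poset_total (T : finType) (h r : rel T) : plane_poset h r ->
  [/\ antisymmetric (relU h r), transitive (relU h r) & total (relU h r)].
Proof.
case/and3P=> /partial_orderP[h1 h2 h3] /partial_orderP[r1 r2 r3] /'forall_forallP c.
have both x y : comparable_in h x y -> comparable_in r x y -> x = y.
  move=> hxy rxy; apply/eqP; apply/negPn/negP=> ne.
  by have := c x y; rewrite ne hxy rxy.
have or x y : comparable_in h x y || comparable_in r x y.
  have [->|ne] := eqVneq x y; first by rewrite /comparable_in h1.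
  by have := c x y; rewrite ne => /eqP->; rewrite orNb.
split=> [x y|y x z|x y] /=.
- case/andP=> /orP[a|a] /orP[b|b]; [by apply: h2; rewrite a|
    by apply: both; rewrite /comparable_in ?a ?b ?orbT|
    by apply: both; rewrite /comparable_in ?a ?b ?orbT|by apply: r2; rewrite a].
- case/orP=> a /orP[b|b]; [by rewrite (h3 _ _ _ a b)| | |by rewrite (r3 _ _ _ a b) orbT].
  + case/orP: (or x z) => /orP[->|d]; rewrite ?orbT //.
      by rewrite -(both y z) ?a // /comparable_in ?(h3 _ _ _ d a) ?b ?orbT.
    by rewrite (both x y) ?b ?orbT // /comparable_in ?(r3 _ _ _ b d) ?a ?orbT.
  + case/orP: (or x z) => /orP[->|d]; rewrite ?orbT //.
      by rewrite (both x y) ?b // /comparable_in ?(h3 _ _ _ b d) ?a ?orbT.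
    by rewrite -(both y z) ?a ?orbT // /comparable_in ?(r3 _ _ _ d a) ?b ?orbT.
- by case/orP: (or x y) => /orP[->|->]; rewrite ?orbT.
Qed.

(** The witness sends an element to the number of elements strictly below it. *)
Lemma total_order_perm (n : nat) (r : rel 'I_n) :
  antisymmetric r -> transitive r -> total r ->
  exists f : 'S_n, forall x y, (f x <= f y)%N = r x y.
Proof.
move=> ra rt rT; have rr : reflexive r by move=> x; case/orP: (rT x x).
pose D x := [set y | r y x && (y != x)].
have Dlt x : (#|D x| < n)%N.
  rewrite -[X in (_ < X)%N]card_ord -cardsT proper_card // properEneq subsetT andbT.
  by apply/eqP=> /setP/(_ x); rewrite !inE eqxx andbF.
have Dmono x y : r x y -> (#|D x| <= #|D y|)%N.
  move=> xy; apply/subset_leq_card/subsetP=> z; rewrite !inE => /andP[zx ne].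
  rewrite (rt _ _ _ zx xy); apply: contraNneq ne => e.
  by apply/eqP/ra; rewrite zx e xy.
have Dsmono x y : r x y -> x != y -> (#|D x| < #|D y|)%N.
  move=> xy ne; apply/proper_card/properP; split; last first.
    by exists x; rewrite !inE ?xy ?eqxx ?andbF.
  apply/subsetP=> z; rewrite !inE => /andP[zx nz].
  rewrite (rt _ _ _ zx xy); apply: contraNneq nz => e.
  by apply/eqP/ra; rewrite zx e xy.
have DE x y : (#|D x| <= #|D y|)%N = r x y.
  apply/idP/idP=> [le|]; last exact: Dmono.
  have [->|ne] := eqVneq x y; first exact: rr.
  by case/orP: (rT x y) => // /Dsmono; rewrite eq_sym => /(_ ne); rewrite ltnNge le.
have fi : injective (fun x => Ordinal (Dlt x)).
  by move=> x y [e]; apply: ra; rewrite -!DE e leqnn.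
by exists (perm fi) => x y; rewrite !permE DE.
Qed.

Section PosetOf.
Variable n : nat.
Implicit Types s t u : 'S_n.

Definition poset_of_data s : dposet_data :=
  Tagged (fun n => ({set 'I_n * 'I_n} * {set 'I_n * 'I_n})%type)
    ([set p : 'I_n * 'I_n | (p.1 <= p.2)%N && (s p.1 <= s p.2)%N],
     [set p : 'I_n * 'I_n | (p.1 <= p.2)%N]).

Fact poset_of_subproof s : partial_order (rel_of (tagged (poset_of_data s)).1)
  && partial_order (rel_of (tagged (poset_of_data s)).2).
Proof.
apply/andP; split; apply/partial_orderP; rewrite /rel_of; split=>
  [x|x y|y x z]; rewrite !inE /= ?leqnn //.
- by case/andP=> /andP[a _] /andP[b _]; apply/val_inj/anti_leq; rewrite a.
- case/andP=> a b /andP[c d].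
  by rewrite (leq_trans a c) (leq_trans b d).
- by move/anti_leq/val_inj.
- exact: leq_trans.
Qed.

Definition poset_of s : dposet := exist _ (poset_of_data s) (poset_of_subproof s).

Lemma le1_poset_of s (i j : 'I_n) :
  @le1 (poset_of s) i j = (i <= j)%N && (s i <= s j)%N.
Proof. by rewrite /le1 /rel_of inE. Qed.

Lemma le2_poset_of s (i j : 'I_n) : @le2 (poset_of s) i j = (i <= j)%N.
Proof. by rewrite /le2 /rel_of inE. Qed.

Lemma special_poset_of s : special (\pi_DP (poset_of s)).
Proof.
rewrite special_pi; apply/special_planeP.
exists (fun i j : 'I_n => (i <= j)%N && (s j <= s i)%N); last first.
  by move=> i j; rewrite le1_poset_of le2_poset_of -andb_orr leq_total andbT.
apply/and3P; split; first by case/andP: (poset_of_subproof s).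
  apply/partial_orderP; split=> [x|x y|y x z]; rewrite ?leqnn //.
    by case/andP=> /andP[a _] /andP[b _]; apply/val_inj/anti_leq; rewrite a.
  case/andP=> a b /andP[c d].
  by rewrite (leq_trans a c) (leq_trans d b).
apply/'forall_forallP=> i j; apply/implyP=> ne; apply/eqP.
have sne : s i != s j by rewrite (inj_eq perm_inj).
rewrite /comparable_in !le1_poset_of.
move: ne sne; rewrite -!(inj_eq val_inj) /=.
by case: ltngtP => // _ _; case: ltngtP.
Qed.

(** An isomorphism preserves [<=_2], so it is the identity, as its own
inversions form the empty set. *)
Lemma poset_of_inj : injective (fun s => \pi_DP (poset_of s)).
Proof.
move=> s t /eqP; rewrite eq_DP => /isobP[f fb [f1 f2]].
have fE : f =1 id.
  have fi := bij_inj fb; pose g : 'S_n := perm fi.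
  have g1 : g = 1%g.
    apply: inversions_inj; apply/setP=> -[i j]; rewrite !inE /= !perm1 !permE.
    have := f2 j i; rewrite !le2_poset_of => e.
    by apply/andP/andP=> -[ij ji]; move: ij;
      rewrite ltnNge ?(ltnW ji) // -e (ltnW ji).
  by move=> i; rewrite -[f i](permE fi) -/g g1 perm1.
apply: inversions_inj; apply/setP=> -[i j]; rewrite !inE /=.
have := f1 i j; rewrite !fE !le1_poset_of.
by have [/ltnW->/= e|] := ltnP i j; rewrite // !ltnNge e.
Qed.

(** A permutation satisfies the first condition exactly when it inverts only pairs
already inverted by [s]; the second is the same condition for its inverse and [t]. *)
Lemma card_pictures_poset_of s t : #|pictures (poset_of s) (poset_of t)| =
  (\sum_u (inversions u \subset inversions s) *
          (inversions (u^-1)%g \subset inversions t))%N.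
Proof.
under eq_bigr do rewrite mulnb; rewrite -big_mkcond sum1_card.
pose F u : {ffun poset_of s -> poset_of t} := finfun u.
have Fi : injective F.
  by move=> u v /ffunP e; apply/permP=> i; have := e i; rewrite !ffunE.
rewrite -(card_imset _ Fi); apply: eq_card => /= f.
have picE u : (F u \in pictures (poset_of s) (poset_of t)) =
    (inversions u \subset inversions s) && (inversions (u^-1)%g \subset inversions t).
  apply/picturesP/andP=> [[_ h1 h2]|[/inversions_subsetP h1 /inversions_subsetP h2]].
    split; apply/inversions_subsetP=> i j.
      move=> ij sij; have := h1 i j.
      by rewrite le1_poset_of le2_poset_of !ffunE ij sij => /(_ isT).
    move=> ij tij; have := h2 ((u^-1)%g i) ((u^-1)%g j).
    by rewrite le1_poset_of le2_poset_of !ffunE !permKV ij tij => /(_ isT).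
  split.
  - apply: (@eq_bij _ _ u); last by move=> i; rewrite ffunE.
    by exists (u^-1)%g; [exact: permK|exact: permKV].
  - by move=> i j; rewrite le1_poset_of le2_poset_of !ffunE => /andP[]; exact: h1.
  move=> i j; rewrite le1_poset_of le2_poset_of !ffunE => /andP[a b].
  by have := h2 _ _ a b; rewrite !permK.
apply/idP/imsetP=> [fP|[u uP ->]]; last by rewrite picE.
case/picturesP: (fP) => /bij_inj fi _ _.
have fE : f = F (perm fi) by apply/ffunP=> i; rewrite ffunE permE.
by exists (perm fi); rewrite // unfold_in -picE -fE.
Qed.

End PosetOf.

Lemma npictures_poset_of_neq (m n : nat) (s : 'S_m) (t : 'S_n) : m != n ->
  npictures (\pi_DP (poset_of s)) (\pi_DP (poset_of t)) = 0%N.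
Proof.
move=> ne; rewrite npictures_pi; apply/eqP; rewrite cards_eq0 -subset0.
apply/subsetP=> f /picturesP[/bij_eq_card + _ _].
by rewrite !card_ord => /eqP; rewrite (negPf ne).
Qed.

(** With [h] for [<=_1] and [r] for [<=_r], both [h U r] and [h U r^op] are total
orders, and their intersection is [h]; the permutation passes from the numbering
along the first to the numbering along the second. *)
Lemma special_plane_poset_of (P : DP) : special P ->
  exists n (s : 'S_n), P = \pi_DP (poset_of s).
Proof.
elim/quotW: P => P; rewrite special_pi.
case/special_planeP=> r plr e.
have plr' : plane_poset (@le1 P) (fun x y => r y x).
  case/and3P: plr => p1 /partial_orderP[r1 r2 r3] /'forall_forallP c.
  apply/and3P; split=> //.
    apply/partial_orderP; split=> [|x y|y x z a b]; [exact: r1| |exact: r3 b a].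
    by rewrite andbC; exact: r2.
  by apply/'forall_forallP=> x y; move: (c x y); rewrite /comparable_in (orbC (r x y)).
have [a1 a2 a3] := plane_poset_total plr.
have [b1 b2 b3] := plane_poset_total plr'.
have [f fE] := total_order_perm a1 a2 a3.
have [g gE] := total_order_perm b1 b2 b3.
exists (tag (val P)), (f^-1 * g)%g; apply/eqP; rewrite eq_DP.
apply/isobP; exists (f : P -> _).
  by exists (f^-1)%g; [exact: permK|exact: permKV].
split=> x y; rewrite ?le1_poset_of ?le2_poset_of ?permM ?permK fE ?gE /= ?e //.
case: (boolP (le1 x y)) => //= nxy; apply/andP=> -[rxy ryx].
case/and3P: plr => /partial_orderP[h1 _ _] /partial_orderP[_ r2 _] _.
by move: nxy; rewrite (r2 x y) ?rxy // h1.
Qed.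

(** * The kernel of the pairing *)

Section Kernel.
Variable K : fieldType.
Implicit Types x : H_DP K.

Lemma pairingUr x (Q : DP) :
  pairing K x << Q >> = \sum_(P <- msupp x) x@_P * (npictures P Q)%:R.
Proof.
apply: eq_bigr => P _.
by rewrite msuppU oner_eq0 big_seq_fset1 mcoeffUU mulr1.
Qed.

(** The weak order seen on isoclasses instead of permutations, so that the sums
over the support of an element, which may mix sizes, need no reindexing. *)
Definition below (n : nat) (u : 'S_n) (P : DP) : bool :=
  [exists s : 'S_n, (P == \pi_DP (poset_of s)) && (inversions u \subset inversions s)].

Lemma below_poset_of (n : nat) (u s : 'S_n) :
  below u (\pi_DP (poset_of s)) = (inversions u \subset inversions s).
Proof.
apply/existsP/idP=> [[t /andP[/eqP/poset_of_inj-> //]]|us].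
by exists s; rewrite eqxx.
Qed.

Lemma npictures_below (n : nat) (P : DP) (t : 'S_n) : special P ->
  npictures P (\pi_DP (poset_of t)) =
  (\sum_(u : 'S_n) below u P * (inversions (u^-1)%g \subset inversions t))%N.
Proof.
case/special_plane_poset_of=> m [s ->].
have [e|ne] := eqVneq m n.
  subst m; rewrite npictures_pi card_pictures_poset_of.
  by apply: eq_bigr => u _; rewrite below_poset_of.
rewrite npictures_poset_of_neq // big1 // => u _.
rewrite [below _ _](_ : _ = false) //; apply/existsP=> -[s' /andP[+ _]]; rewrite eq_DP => /isobP[f /bij_eq_card + _].
by rewrite !card_ord => /eqP; rewrite (negPf ne).
Qed.

Definition upper_sum x (n : nat) (u : 'S_n) : K :=
  \sum_(P <- msupp x) x@_P * (below u P)%:R.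

Lemma pairing_poset_of x (n : nat) (t : 'S_n) : x \in H_SPP K ->
  pairing K x << \pi_DP (poset_of t) >> =
  \sum_(u : 'S_n | inversions (u^-1)%g \subset inversions t) upper_sum x u.
Proof.
move=> /allP xS; rewrite pairingUr exchange_big /= !big_seq.
apply: eq_bigr => P /xS sP; rewrite npictures_below // natr_sum mulr_sumr.
rewrite [RHS]big_mkcond; apply: eq_bigr => u _.
by case: (_ \subset _); rewrite ?muln1 // muln0 mulr0.
Qed.

(** Pairing with [P_t] for [t = u^-1] gives the sum of [upper_sum x v] over the [v]
with [v^-1 <= u^-1]; all terms but the one at [u] vanish by induction on the
number of inversions of the inverse. *)
Lemma upper_sum_eq0 x (n : nat) (u : 'S_n) : x \in H_SPP K ->
  (forall y, y \in H_SPP K -> pairing K x y = 0) -> upper_sum x u = 0.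
Proof.
move=> xS x0.
have [m] := ubnP #|inversions (u^-1)%g|; elim: m => // m IHm in u *.
rewrite ltnS => um.
have /x0 : << \pi_DP (poset_of (u^-1)%g) >> \in H_SPP K.
  by apply/allP=> P; rewrite msuppU oner_eq0 inE => /eqP->; exact: special_poset_of.
rewrite pairing_poset_of // (bigD1 u) //= big1 ?addr0 // => v /andP[vu ne].
apply: IHm; apply: leq_trans um; apply: inversions_ltn_card => //.
by rewrite (inj_eq invg_inj).
Qed.

(** If the support of [x] contained some [P_s], then for such an [s] with the largest
number of inversions [upper_sum x s] would be the coefficient of [x] at [P_s]. *)
Lemma kernel_pairing_SPP x : x \in H_SPP K ->
  (forall y, y \in H_SPP K -> pairing K x y = 0) -> x = 0.
Proof.
move=> xS x0; apply/malgP => P; rewrite mcoeff0; apply/eqP.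
apply/negPn/negP; rewrite mcoeff_neq0 => Px.
have [n [s0 eP]] := special_plane_poset_of (allP xS P Px).
pose supp (s : 'S_n) := \pi_DP (poset_of s) \in msupp x.
have s0S : supp s0 by rewrite /supp -eP.
case: (arg_maxnP (fun s => #|inversions s|) s0S) => s sS smax.
have := upper_sum_eq0 s xS x0; rewrite /upper_sum (big_fsetD1 _ sS) /=.
rewrite below_poset_of subxx mulr1 big_seq big1 ?addr0.
  by move/eqP; rewrite mcoeff_eq0 -/(supp s) sS.
move=> Q; rewrite !inE => /andP[ne Qx].
case: (boolP (below s Q)) => [/existsP[t /andP[/eqP eQ st]]|]; last by rewrite mulr0.
have ts : s != t by apply: contraNneq ne => ->; rewrite eQ.
have := smax t; rewrite /supp -eQ => /(_ Qx).
by rewrite /= leqNgt (inversions_ltn_card st ts).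
Qed.

End Kernel.

Theorem corollary4p6 (K : fieldType) : nondegenerate_on (pairing K) (H_SPP K).
Proof.
split=> [x|y yS y0]; first exact: kernel_pairing_SPP.
by apply: kernel_pairing_SPP => // x xS; rewrite pairing_sym y0.
Qed.
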